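(* Let $\mathfrak C$ be a left cancellative small category. The following are equivalent: (a) $\partial\Omega$ is the smallest non-empty closed invariant subspace of $\widehat{\mathcal J}$; (b) $\partial\Omega$ is the smallest non-empty closed invariant subspace of $\Omega$; (c) for all $\mathfrak v,\mathfrak w\in\mathfrak C^0$ we have $\mathfrak w\mathfrak C\mathfrak v\ne\emptyset$. In that case, $I_l\ltimes\partial\Omega$ is purely infinite (in the sense of Matui) if and only if for all $\mathfrak v\in\mathfrak C^0$ there exist $a,b\in\mathfrak v\mathfrak C$ with $a\mathfrak C\cap b\mathfrak C=\emptyset$.
   Context: $\mathfrak C$ denotes the set of morphisms, $\mathfrak C^0\subseteq\mathfrak C$ the identity morphisms (identified with objects), $\mathfrak d,\mathfrak t$ domain and target; $cd$ is defined iff $\mathfrak d(c)=\mathfrak t(d)$; left cancellative means $cx=cy\Rightarrow x=y$. $c\mathfrak C=\{cx:\mathfrak t(x)=\mathfrak d(c)\}$, and $\mathfrak w\mathfrak C\mathfrak v$ is the set of $x$ with $\mathfrak t(x)=\mathfrak w$, $\mathfrak d(x)=\mathfrak v$. Each $c\in\mathfrak C$ gives the partial bijection $\mathfrak d(c)\mathfrak C\to c\mathfrak C$, $x\mapsto cx$; $I_l$ is the smallest semigroup of partial bijections of $\mathfrak C$ containing these and closed under inverses; $\mathcal J=\{\mathrm{dom}(s):s\in I_l\}$ is its semilattice of idempotents (product = intersection). $\widehat{\mathcal J}$ is the space of non-zero multiplicative maps $\chi:\mathcal J\to\{0,1\}$ with $\chi(\emptyset)=0$ if $\emptyset\in\mathcal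 J$ (pointwise convergence). $\Omega\subseteq\widehat{\mathcal J}$ consists of those $\chi$ such that whenever $e=\bigcup_{i=1}^nf_i$ ($e,f_i\in\mathcal J$) and $\chi(e)=1$, then $\chi(f_i)=1$ for some $i$. $\partial\Omega\subseteq\Omega$ is the closure of the set of $\chi\in\widehat{\mathcal J}$ with $\chi^{-1}(1)$ maximal. $s\in I_l$ acts by $\chi\mapsto s.\chi=\chi(s^{-1}\cdot s)$ from $\{\chi(s^{-1}s)=1\}$ onto $\{\chi(ss^{-1})=1\}$; $\Omega$ and $\partial\Omega$ are invariant. Invariant subspaces are subsets closed under this partial action. $I_l\ltimes\partial\Omega$ is the transformation groupoid: classes $[s,\chi]$ with $\chi\in\partial\Omega$, $\chi(s^{-1}s)=1$, $[s,\chi]=[t,\chi]$ iff $se=te$ for some $e\in\mathcal J$ with $\chi(e)=1$; source $\chi$, range $s.\chi$; topology such that $\{[s,\chi]:\chi(s^{-1}s)=1\}$ is open and mapped homeomorphically by the source map onto $\{\chi\in\partial\Omega:\chi(s^{-1}s)=1\}$. An étale groupoid $\mathcal G$ with totally disconnected locally compact Hausdorff unit space is purely infinite (Matui) if for every compact open $B\subseteq\mathcal G^{(0)}$ there are compact open bisections $U,V\subseteq\mathcal G$ with $\mathrm s(U)=\mathrm s(V)=B$, $\mathrm r(U)\cup\mathrm r(V)\subseteq B$ and $\mathrm r(U)\cap\mathrm r(V)=\emptyset$. *)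

(* Defs.v *)
From HB Require Import structures.
From mathcomp Require Import all_boot generic_quotient.
From mathcomp Require Import all_classical all_analysis.

Set Implicit Arguments.
Unset Strict Implicit.
Unset Printing Implicit Defensive.

Local Open Scope classical_set_scope.
Local Open Scope quotient_scope.

(* Small categories, arrows only: an object is identified with its identity   *)
(* morphism, and [compose c d] (first [d], then [c]) is the composite when       *)
(* [dom c = tgt d]; its value is irrelevant otherwise.                        *)
Record smallCat := SmallCat {
  mor :> Type;
  dom : mor -> mor;
  tgt : mor -> mor;
  compose : mor -> mor -> mor;
  dom_dom : forall c, dom (dom c) = dom c;
  tgt_dom : forall c, tgt (dom c) = dom c;
  dom_tgt : forall c, dom (tgt c) = tgt c;
  tgt_tgt : forall c, tgt (tgt c) = tgt c;
  dom_compose : forall c d, dom c = tgt d -> dom (compose c d) = dom d;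
  tgt_compose : forall c d, dom c = tgt d -> tgt (compose c d) = tgt c;
  composeA : forall b c d, dom b = tgt c -> dom c = tgt d ->
    compose b (compose c d) = compose (compose b c) d;
  compose_dom : forall c, compose c (dom c) = c;
  compose_tgt : forall c, compose (tgt c) c = c
}.

Definition left_cancellative (C : smallCat) : Prop :=
  forall c x y : C, dom c = tgt x -> dom c = tgt y ->
    compose c x = compose c y -> x = y.

Record lcsCat := LcsCat {
  lcs_cat :> smallCat;
  lcsP : left_cancellative lcs_cat
}.

Section Category.
Variable C : smallCat.

Definition objects : set C := [set v | dom v = v].

Definition homset (w v : C) : set C := [set x | tgt x = w /\ dom x = v].

Definition ideal (c : C) : set C := [set compose c x | x in [set x | tgt x = dom c]].

(* Partial maps of C are represented by their graphs. In relation_scope,      *)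
(* [s \; t] is the product s t, that is, first t and then s.                  *)
Definition lmul (c : C) : set (C * C) :=
  [set (x, compose c x) | x in [set x | tgt x = dom c]].

Definition pdom (s : set (C * C)) : set C := [set x | exists y, s (x, y)].

Definition pid (e : set C) : set (C * C) := [set (x, x) | x in e].

Definition partial_bijection (s : set (C * C)) : Prop :=
  (forall x y y', s (x, y) -> s (x, y') -> y = y') /\
  (forall x x' y, s (x, y) -> s (x', y) -> x = x').

Inductive Il : set (set (C * C)) :=
| Il_lmul c : Il (lmul c)
| Il_comp s t : Il s -> Il t -> Il (s \; t)%relation
| Il_inv s : Il s -> Il (s^-1)%relation.

Definition J : set (set C) := [set pdom s | s in Il].

End Category.

Arguments objects : clear implicits.
Arguments Il : clear implicits.
Arguments J : clear implicits.

Section InverseHull.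
Variable C : lcsCat.
Local Notation Il := (Il C).
Local Notation J := (J C).

Lemma Il_pbij s : Il s -> partial_bijection s.
Proof.
elim=> [c|s1 t1 _ [fs is_] _ [ft it]|s1 _ [fs is_]]; split.
- by move=> x y y' [a _ [<- <-]] [b _ [-> <-]].
- move=> x x' y [a /= ta [<- <-]] [b /= tb [<- ]].
  by move=> /esym; apply: (@lcsP C c).
- move=> x y y' [z /= tz sz] [z' /= tz' sz'].
  by move: sz; rewrite (ft _ _ _ tz tz') => /fs; apply.
- move=> x x' y [z /= tz sz] [z' /= tz' sz'].
  by move: tz; rewrite (is_ _ _ _ sz sz') => /it; apply.
- by move=> x y y' /= h h'; exact: is_ h h'.
- by move=> x x' y /= h h'; exact: fs h h'.
Qed.

Lemma JP s : Il s -> pdom s \in J.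
Proof. by move=> ils; apply/mem_set; exists s. Qed.

Lemma pdom_comp (s t : set (C * C)) :
  pdom (s \; t)%relation = [set x | exists y, t (x, y) /\ pdom s y].
Proof.
apply/seteqP; split=> x.
  by move=> [z [y /= ty sy]]; exists y; split=> //; exists z.
by move=> [y [ty [z sy]]]; exists z, y.
Qed.

Lemma pdom_conj (s : set (C * C)) (e : set C) :
  pdom (s^-1 \; pid e \; s)%relation = [set x | exists y, s (x, y) /\ e y].
Proof.
apply/seteqP; split=> x.
  by move=> [x' [y [z /= sz [a ea [az ay]]] sy]]; exists z; split => //; rewrite -az.
by move=> [y [sy ey]]; exists x; exists y => //=; exists y => //=; exists y.
Qed.

Lemma pdom_conj_in (s : set (C * C)) (e : set C) :
  Il s -> e \in J -> pdom (s^-1 \; pid e \; s)%relation \in J.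
Proof.
move=> ils /set_mem[t ilt <-]; rewrite pdom_conj -pdom_comp.
by apply: JP; exact: Il_comp.
Qed.

Lemma pdomI_in (e f : set C) : e \in J -> f \in J -> e `&` f \in J.
Proof.
move=> /set_mem[s ils <-] /set_mem[t ilt <-].
suff -> : pdom s `&` pdom t = pdom (t \; s^-1 \; s)%relation.
  by apply: JP; apply: Il_comp => //; apply: Il_comp => //; exact: Il_inv.
have [_ is_] := Il_pbij ils.
apply/seteqP; split=> x.
  by move=> [[y sy] [z tz]]; exists z, x => //=; exists y.
move=> [z [x' [y /= sy sy'] tz]]; rewrite (is_ _ _ _ sy sy'); split.
  by exists y.
by exists z.
Qed.

(* The semilattice of idempotents: [pid e] is identified with its domain [e]. *)
Definition Jdom (s : Il) : J := exist (fun e => e \in J) _ (JP (set_mem (valP s))).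

Definition Jinv (s : Il) : Il :=
  exist (fun s => s \in Il) _ (mem_set (Il_inv (set_mem (valP s)))).

Definition Jmeet (e f : J) : J := exist (fun e => e \in J) _ (pdomI_in (valP e) (valP f)).

(* s^-1 e s *)
Definition Jconj (s : Il) (e : J) : J :=
  exist (fun e => e \in J) _ (pdom_conj_in (set_mem (valP s)) (valP e)).

Definition is_character (chi : J -> bool) : Prop :=
  [/\ exists e, chi e,
      forall e f, chi (Jmeet e f) = chi e && chi f &
      forall e, val e = set0 -> chi e = false].

Definition Jhat : set {ptws J -> bool} := [set chi | is_character chi].

Definition ev (chi : Jhat) (e : J) : bool := (val chi : J -> bool) e.

(* n = 0 is harmless: then e is empty and chi e = 0. *)
Definition Omega : set Jhat :=
  [set chi | forall (e : J) (n : nat) (f : 'I_n -> J),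
     val e = \bigcup_i val (f i) -> ev chi e -> exists i, ev chi (f i)].

Definition support (chi : Jhat) : set J := [set e | ev chi e].

Definition maximal_character : set Jhat :=
  [set chi | forall psi, support chi `<=` support psi ->
     support psi = support chi].

Definition bOmega : set Jhat := closure maximal_character.

Lemma val_Jconj (s : Il) (e : J) :
  val (Jconj s e) = [set x | exists y, (val s) (x, y) /\ val e y].
Proof. by rewrite /Jconj /= pdom_conj. Qed.

Lemma act_subproof (s : Il) (chi : Jhat) : ev chi (Jdom s) ->
  is_character (fun e => ev chi (Jconj s e)).
Proof.
have [_ chiI chi0] := set_mem (valP chi).
move=> chis; split.
- exists (Jdom (Jinv s)); suff -> : Jconj s (Jdom (Jinv s)) = Jdom s by [].
  apply: val_inj; rewrite val_Jconj; apply/seteqP; split=> x.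
    by move=> [y [sy _]]; exists y.
  by move=> [y sy]; exists y; split=> //; exists x.
- move=> e f; rewrite -[RHS]chiI; congr (ev chi _).
  apply: val_inj; rewrite val_Jconj [RHS]/= !pdom_conj.
  have [fs _] := Il_pbij (set_mem (valP s)).
  apply/seteqP; split=> x.
    by move=> [y [sy [ey fy]]]; split; exists y.
  move=> [[y [sy ey]] [y' [sy' fy]]]; exists y; split=> //; split=> //.
  by rewrite (fs _ _ _ sy sy').
- move=> e e0; apply: chi0; rewrite val_Jconj e0.
  by apply/seteqP; split=> x // [y []].
Qed.

(* s.chi = chi (s^-1 . s), defined when chi (s^-1 s) = 1 *)
Definition act (s : Il) (chi : Jhat) (h : ev chi (Jdom s)) : Jhat :=
  exist (fun chi => chi \in Jhat) _ (mem_set (act_subproof h)).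

Definition invariant (X : set Jhat) : Prop :=
  forall (s : Il) (chi : Jhat) (h : ev chi (Jdom s)), X chi -> X (act h).

(* Closedness is relative to Y. For the empty category Jhat is empty, so no   *)
(* such X exists.                                                             *)
Definition nonempty_closed_invariant (Y X : set Jhat) : Prop :=
  [/\ X `<=` Y, X !=set0, closed (X : set (subspace Y)) & invariant X].

Definition smallest_closed_invariant (Y X : set Jhat) : Prop :=
  nonempty_closed_invariant Y X /\
  forall Z, nonempty_closed_invariant Y Z -> X `<=` Z.


Lemma ev_continuous (e : J) : continuous (fun chi : Jhat => ev chi e).
Proof.
move=> chi; apply: (@continuous_comp _ _ _ (val : Jhat -> {ptws J -> bool})
  (fun f => (f : J -> bool) e)); first exact: initial_continuous.
exact: (@proj_continuous J (fun=> bool)).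
Qed.

Lemma open_ev (e : J) : open [set chi : Jhat | ev chi e].
Proof.
have /continuousP/(_ [set true]) := @ev_continuous e.
by apply; exact: discrete_open.
Qed.

Lemma evI (chi : Jhat) (e f : J) : ev chi (Jmeet e f) = ev chi e && ev chi f.
Proof. by have [_ + _] := set_mem (valP chi); apply. Qed.

Lemma Jhat_ext (chi psi : Jhat) : ev chi =1 ev psi -> chi = psi.
Proof. by move=> h; apply: val_inj; apply/funext. Qed.

Lemma ev_act (s : Il) (chi : Jhat) (h : ev chi (Jdom s)) (e : J) :
  ev (act h) e = ev chi (Jconj s e).
Proof. by []. Qed.

Lemma JinvK (s : Il) : Jinv (Jinv s) = s.
Proof. by apply: val_inj; apply/seteqP; split=> -[]. Qed.

Lemma Jconj_Jinv (s : Il) (e : J) :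
  Jconj s (Jconj (Jinv s) e) = Jmeet e (Jdom s).
Proof.
apply: val_inj; rewrite val_Jconj [RHS]/= val_Jconj /=.
have [_ is_] := Il_pbij (set_mem (valP s)).
apply/seteqP; split=> x.
  move=> [y [sy [x' [sy' ex]]]]; rewrite (is_ _ _ _ sy sy'); split=> //.
  by exists y.
by move=> [ex [y sy]]; exists y; split=> //; exists x.
Qed.

Lemma act_ran (s : Il) (chi : Jhat) (h : ev chi (Jdom s)) :
  ev (act h) (Jdom (Jinv s)).
Proof.
rewrite ev_act; suff -> : Jconj s (Jdom (Jinv s)) = Jdom s by [].
apply: val_inj; rewrite val_Jconj; apply/seteqP; split=> x.
  by move=> [y [sy _]]; exists y.
by move=> [y sy]; exists y; split=> //; exists x.
Qed.

Lemma invariant_maximal : invariant maximal_character.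
Proof.
move=> s chi h maxchi psi lepsi; apply/seteqP; split=> // e /= psie.
have ran_psi : ev psi (Jdom (Jinv s)) by apply: lepsi; exact: act_ran.
suff : support chi (Jconj s e) by [].
have <- : support (act ran_psi) = support chi; last first.
  by rewrite /support/= ev_act -{2}(JinvK s) Jconj_Jinv evI psie.
apply: maxchi => f /= chif; rewrite /support/= ev_act; apply: lepsi.
by rewrite /support/= ev_act Jconj_Jinv evI [ev _ f]chif.
Qed.

(* s.chi where defined, and chi elsewhere *)
Definition act_total (s : Il) (chi : Jhat) : Jhat :=
  if pselect (ev chi (Jdom s)) is left h then act h else chi.

Lemma act_totalE (s : Il) (chi : Jhat) (h : ev chi (Jdom s)) :
  act_total s chi = act h.
Proof.
rewrite /act_total; case: pselect => // h'.
by rewrite (bool_irrelevance h h').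
Qed.

Lemma act_total_continuous (s : Il) (chi : Jhat) (h : ev chi (Jdom s)) :
  {for chi, continuous (act_total s)}.
Proof.
rewrite /continuous_at.
have cvgt : (fun psi => val (act_total s psi) : {ptws J -> bool}) @ chi -->
    (val (act_total s chi) : {ptws J -> bool}).
  have ? := fmap_filter (fun psi => val (act_total s psi)) (nbhs_filter chi).
  apply/cvg_sup.
  move=> e A; rewrite nbhsE => -[_ [[V oV <-] /= Ve] VA].
  apply: (@filterS _ _ _ [set psi | V (ev (act_total s psi) e)]).
    by move=> psi; exact: VA.
  have nV : \forall psi \near chi, V (ev psi (Jconj s e)).
    have /(_ V) := @ev_continuous (Jconj s e) chi; apply.
    apply: open_nbhs_nbhs; split=> //.
    by move: Ve; rewrite (act_totalE h).
  have nD : \forall psi \near chi, ev psi (Jdom s).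
    by apply: open_nbhs_nbhs; split => //; exact: open_ev.
  by apply: filterS2 nV nD => psi Vpsi hpsi /=; rewrite (act_totalE hpsi).
move=> A; rewrite nbhsE => -[_ [[V oV <-] Vchi] VA].
have ? := fmap_filter (act_total s) (nbhs_filter chi).
apply: filterS VA _; have /(_ V) := cvgt; apply.
by apply: open_nbhs_nbhs.
Qed.

Lemma invariant_bOmega : invariant bOmega.
Proof.
move=> s chi h clchi; rewrite -(act_totalE h) => A nA.
have nA' : nbhs chi ([set psi | ev psi (Jdom s)] `&` act_total s @^-1` A).
  apply: filterI; last exact: act_total_continuous.
  by apply: open_nbhs_nbhs; split => //; exact: open_ev.
have [psi [maxpsi [hpsi Apsi]]] := clchi _ nA'.
exists (act_total s psi); split=> //.
by rewrite (act_totalE hpsi); exact: invariant_maximal.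
Qed.

Definition bact (s : Il) (chi : bOmega) (h : ev (val chi) (Jdom s)) : bOmega :=
  exist (fun chi => chi \in bOmega) _ (mem_set (@invariant_bOmega s (val chi) h (set_mem (valP chi)))).

Definition pregerm : set (Il * bOmega) :=
  [set p | ev (val p.2) (Jdom p.1)].

(* [s, chi] = [t, chi] iff s e = t e for some idempotent e with chi e = 1 *)
Definition germ_rel (p q : pregerm) : bool :=
  `[< (val p).2 = (val q).2 /\
      exists e, ev (val (val p).2) e /\
        (val (val p).1 \; pid (val e) = val (val q).1 \; pid (val e))%relation >].

Lemma pid_compP (e : set C) (s t : set (C * C)) :
  (s \; pid e = t \; pid e)%relation <->
  forall x, e x -> forall y, s (x, y) <-> t (x, y).
Proof.
have pidE r x y : (r \; pid e)%relation (x, y) <-> e x /\ r (x, y).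
  split; first by move=> [z /= [a ea [<- <-]]].
  by move=> [ex rxy]; exists x => //=; exists x.
split=> [est x ex y|est].
  split=> [sxy|txy].
    suff /pidE[] : (t \; pid e)%relation (x, y) by [].
    by rewrite -est; apply/pidE.
  suff /pidE[] : (s \; pid e)%relation (x, y) by [].
  by rewrite est; apply/pidE.
by apply/seteqP; split=> -[x y] /pidE[ex] /(est _ ex) sxy; apply/pidE.
Qed.

Lemma germ_rel_refl : reflexive germ_rel.
Proof.
move=> p; apply/asboolP; split=> //; exists (Jdom (val p).1); split=> //.
exact: (set_mem (valP p)).
Qed.

Lemma germ_rel_sym : symmetric germ_rel.
Proof.
suff sym p q : germ_rel p q -> germ_rel q p by move=> p q; apply/idP/idP => /sym.
move=> /asboolP[pq [e [ce est]]]; apply/asboolP; split=> //.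
by exists e; rewrite -pq; split.
Qed.

Lemma germ_rel_trans : transitive germ_rel.
Proof.
move=> q p r /asboolP[pq [e [ce /pid_compP est]]].
move=> /asboolP[qr [f [cf /pid_compP fstt]]].
apply/asboolP; split; first by rewrite pq.
exists (Jmeet e f); rewrite evI ce /= pq cf; split=> //.
by apply/pid_compP => x [ex fx] y; rewrite (est x ex) (fstt x fx).
Qed.

Canonical germ_equiv := EquivRel germ_rel germ_rel_refl germ_rel_sym germ_rel_trans.

Definition germ : Type := {eq_quot germ_equiv}.

HB.instance Definition _ := Choice.on germ.

Definition mk_germ (s : Il) (chi : bOmega) (h : ev (val chi) (Jdom s)) : germ :=
  (\pi_({eq_quot germ_equiv}) (exist (fun p => p \in pregerm) (s, chi) (mem_set h))).

(* Computed on representatives; see [germ_src_mk] and [germ_rng_mk]. *)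
Definition germ_src (g : germ) : bOmega := (val (repr (g : {eq_quot germ_equiv}))).2.

Definition germ_rng (g : germ) : bOmega :=
  bact (set_mem (valP (repr (g : {eq_quot germ_equiv})))).

Lemma mk_germP (s t : Il) (chi psi : bOmega)
    (h : ev (val chi) (Jdom s)) (k : ev (val psi) (Jdom t)) :
  mk_germ h = mk_germ k <->
  chi = psi /\ exists e, ev (val chi) e /\
    (val s \; pid (val e) = val t \; pid (val e))%relation.
Proof.
split; first by move=> /eqmodP/asboolP.
by move=> hk; apply/eqmodP/asboolP.
Qed.

Lemma mk_germ_ex (g : germ) : exists s chi (h : ev (val chi) (Jdom s)), g = mk_germ h.
Proof.
elim/quotW: (g : {eq_quot germ_equiv}) => -[[s chi] h].
exists s, chi, (set_mem h); rewrite /mk_germ; congr (\pi_ _ _).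
exact: val_inj.
Qed.

Lemma germ_src_mk (s : Il) (chi : bOmega) (h : ev (val chi) (Jdom s)) :
  germ_src (mk_germ h) = chi.
Proof.
rewrite /germ_src; set p : pregerm := exist (fun p => p \in pregerm) (s, chi) (mem_set h).
by have /eqmodP/asboolP[-> _] : (repr (\pi_({eq_quot germ_equiv}) p) = p %[mod {eq_quot germ_equiv}])
  by rewrite reprK.
Qed.

Lemma germ_rng_mk (s : Il) (chi : bOmega) (h : ev (val chi) (Jdom s)) :
  germ_rng (mk_germ h) = bact h.
Proof.
rewrite /germ_rng; set p : pregerm := exist (fun p => p \in pregerm) (s, chi) (mem_set h).
set q := repr _.
have /eqmodP/asboolP[qp [e [qe /pid_compP eqp]]] : (q = p %[mod {eq_quot germ_equiv}])
  by rewrite reprK.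
apply: val_inj => /=; apply: Jhat_ext => f; rewrite !ev_act /=.
have -> : ev (val (val q).2) (Jconj (val q).1 f) = ev (val (val q).2) (Jmeet e (Jconj (val q).1 f)).
  by rewrite evI qe.
have -> : ev (val chi) (Jconj s f) = ev (val chi) (Jmeet e (Jconj s f)).
  by rewrite evI -[chi]/(val p).2 -qp qe.
rewrite qp; congr (ev _ _); apply: val_inj; rewrite /= !pdom_conj.
by apply/seteqP; split=> x [ex [y [sy fy]]]; split=> //; exists y; split=> //;
  move: sy; rewrite eqp.
Qed.

(* The topology for which the sets {[s, chi] : chi (s^-1 s) = 1} are open and *)
(* mapped homeomorphically by the source map onto {chi : chi (s^-1 s) = 1};   *)
(* see [germ_bisection_open], [germ_src_continuous], [germ_src_inj] and       *)
(* [germ_src_open] below.                                                     *)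
Definition germ_open (V : set germ) : Prop :=
  forall s : Il, open [set chi : bOmega |
    exists h : ev (val chi) (Jdom s), V (mk_germ h)].

Lemma open_bev (e : J) : open [set chi : bOmega | ev (val chi) e].
Proof.
have /continuousP/(_ [set chi : Jhat | ev chi e]) :=
  @initial_continuous bOmega Jhat val.
by apply; exact: open_ev.
Qed.

Lemma germ_openT : germ_open setT.
Proof.
move=> s; have := open_bev (Jdom s); congr open.
by apply/seteqP; split => chi //= [].
Qed.

Lemma germ_openI : setI_closed germ_open.
Proof.
move=> V W oV oW s; have := openI (oV s) (oW s); congr open.
apply/seteqP; split => chi /=; last by move=> [h [Vh Wh]]; split; exists h.
by move=> [[h Vh] [h' Wh]]; exists h; split=> //; rewrite (bool_irrelevance h h').
Qed.

Lemma germ_open_bigU (I : Type) (V : I -> set germ) :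
  (forall i, germ_open (V i)) -> germ_open (\bigcup_i V i).
Proof.
move=> oV s; have := bigcup_open (fun i (_ : setT i) => oV i s); congr open.
apply/seteqP; split => chi /=; first by move=> [i _ [h Vh]]; exists h, i.
by move=> [h [i _ Vh]]; exists i => //; exists h.
Qed.

HB.instance Definition _ :=
  isOpenTopological.Build germ germ_openT germ_openI germ_open_bigU.

Lemma germ_openE : open = germ_open.
Proof. by []. Qed.

Definition germ_bisection (s : Il) : set germ :=
  [set g | exists chi (h : ev (val chi) (Jdom s)), g = mk_germ h].

Lemma germ_bisection_open (s : Il) : open (germ_bisection s).
Proof.
move=> t.
pose D := [set e : J | (val s \; pid (val e) = val t \; pid (val e))%relation].
have := openI (openI (open_bev (Jdom s)) (open_bev (Jdom t)))
   (bigcup_open (fun e (_ : D e) => open_bev e)).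
congr open; apply/seteqP; split=> chi /=.
  move=> [[hs ht] [e De ce]]; exists ht, chi, hs; apply/mk_germP; split=> //.
  by exists e.
move=> [ht [psi [hs /mk_germP[cp [e [ce est]]]]]]; move: hs; rewrite -cp => hs.
by split=> //; exists e.
Qed.

Lemma germ_src_continuous : continuous germ_src.
Proof.
apply/continuousP => A oA; rewrite germ_openE => s; have := openI oA (open_bev (Jdom s)); congr open.
apply/seteqP; split=> chi /=.
  by move=> [Ac h]; exists h; rewrite germ_src_mk.
by move=> [h]; rewrite germ_src_mk.
Qed.

Lemma germ_src_inj (s : Il) (g g' : germ) : germ_bisection s g ->
  germ_bisection s g' -> germ_src g = germ_src g' -> g = g'.
Proof.
move=> [chi [h ->]] [psi [h' ->]]; rewrite !germ_src_mk => cp.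
by rewrite {}cp in h *; rewrite (bool_irrelevance h h').
Qed.

Lemma germ_src_open (V : set germ) : open V -> open (germ_src @` V).
Proof.
move=> oV; have := bigcup_open (fun s (_ : setT s) => oV s); congr open.
apply/seteqP; split=> chi /=.
  by move=> [s _ [h Vh]]; exists (mk_germ h) => //; rewrite germ_src_mk.
move=> [g Vg]; have [s [psi [h gE]]] := mk_germ_ex g.
by rewrite gE germ_src_mk => <-; exists s => //; exists h; rewrite -gE.
Qed.

Lemma germ_src_bisection (s : Il) :
  germ_src @` germ_bisection s = [set chi | ev (val chi) (Jdom s)].
Proof.
apply/seteqP; split=> chi /=; first by move=> [g [psi [h ->]] <-]; rewrite germ_src_mk.
by move=> h; exists (mk_germ h); [exists chi, h|rewrite germ_src_mk].
Qed.

End InverseHull.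

Arguments Jhat : clear implicits.
Arguments Omega : clear implicits.
Arguments bOmega : clear implicits.
Arguments maximal_character : clear implicits.

(* G is the arrow space and X the unit space of an etale groupoid; only the   *)
(* topology and the source and range maps enter.                              *)
Section PureInfiniteness.
Variables (G X : topologicalType) (src rng : G -> X).

Definition bisection (U : set G) : Prop :=
  {in U &, injective src} /\ {in U &, injective rng}.

Definition compact_open_bisection (U : set G) : Prop :=
  [/\ compact U, open U & bisection U].

Definition purely_infinite : Prop :=
  forall B : set X, compact B -> open B ->
    exists U V : set G,
      [/\ compact_open_bisection U, compact_open_bisection V,
          src @` U = B /\ src @` V = B,
          rng @` U `|` rng @` V `<=` B &
          rng @` U `&` rng @` V = set0].

End PureInfiniteness.

(* Main.v *)
Require Import Defs.
From mathcomp Require Import all_boot.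
From mathcomp Require Import all_classical all_analysis.

(** A maximal character psi vanishes at e only if psi(f) = 1 for some f disjoint
    from e ([maximal_separates]). Hence maximal characters lie in Omega, and
    psi has a neighbourhood basis of sets of characters with value 1 at e, for e
    a nonempty member of J ([nbhs_maximal]). As every member e of J is a right
    ideal, left multiplication by any c in e maps its whole domain into e, and
    so maps every character with value 1 at d(c)C to one with value 1 at e
    ([translate_into]).

    Minimality. Every character has value 1 at vC for some object v. If all
    objects are connected, each nonempty e in J contains an arrow c with domain
    v, so an invariant set with a point meets every neighbourhood of every
    maximal character; its closure contains the boundary
    ([connected_smallest]). Since Omega is closed and contains the boundary,
    minimality passes from the space of all characters to Omega
    ([smallest_Omega]). Conversely, the principal character at v lies in Omega,
    and it is moved by s to a character with value 1 at wC only if s(v) is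
    an arrow from v to w ([smallest_connected]).

    Pure infiniteness. Suppose that all objects are connected. If every object
    has two disjoint right ideals, then below any arrow there are infinitely
    many pairwise disjoint ones. A nonempty compact open B meets only finitely
    many of the sets given by chi(vC) = 1, v an object, and contains the boundary
    characters with value 1 at some nonempty e in J; translating each of these
    pieces of B into its own ideal inside e, twice, gives the two bisections
    ([disjoint_ideals_purely_infinite]). Conversely, the two bisections for the
    compact open set given by chi(vC) = 1 have disjoint ranges, each containing
    all the boundary characters with value 1 at some nonempty member of J. Two
    such members are disjoint and both meet vC, which yields a and b
    ([purely_infinite_disjoint_ideals]). *)

Set Implicit Arguments.
Unset Strict Implicit.
Unset Printing Implicit Defensive.

Local Open Scope classical_set_scope.

Local Notation support := Defs.support.
Local Notation invariant := Defs.invariant.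

Section InverseHullTheory.
Variable C : lcsCat.
Implicit Types (e f : J C) (s t : Il C) (chi psi : Jhat C).

(** * Right ideals and the inverse hull *)

(** Every element of the inverse hull commutes with right multiplication, and
    preserves domains. *)
Lemma Il_equivariant (s : set (C * C)) x z : Il C s -> s (x, z) ->
  dom x = dom z /\ forall y, tgt y = dom x -> s (compose x y, compose z y).
Proof.
move=> ils; elim: ils x z => {s} [c|s t _ IHs _ IHt|s _ IHs] x z.
- move=> [x' /= tx [<- <-]]; rewrite dom_compose//; split=> // y ty.
  by rewrite -composeA//; exists (compose x' y) => //=; rewrite tgt_compose.
- move=> [w /= /IHt[dxw tP] /IHs[dwz sP]]; split; first by rewrite dxw.
  move=> y ty; exists (compose w y) => /=; first exact: tP.
  by apply: sP; rewrite -dxw.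
- by move=> /IHs[dzx sP]; split=> // y ty; apply: sP; rewrite dzx.
Qed.

Lemma J_right_ideal e x y : val e x -> tgt y = dom x -> val e (compose x y).
Proof.
case: e => /= e /set_mem[s ils <-] [z sxz] ty.
by have [_ /(_ _ ty)] := Il_equivariant ils sxz; exists (compose z y).
Qed.

Lemma ideal_sub e x : val e x -> ideal x `<=` val e.
Proof. by move=> ex _ [y /= ty <-]; exact: J_right_ideal. Qed.

Lemma ideal_self (x : C) : ideal x x.
Proof. by exists (dom x); rewrite /= ?tgt_dom ?compose_dom. Qed.

Lemma ideal_compose (x y : C) : dom x = tgt y ->
  ideal (compose x y) `<=` ideal x.
Proof.
move=> xy _ [z /= tz <-]; exists (compose y z); rewrite /= ?tgt_compose -?tz//.
  by move: tz; rewrite dom_compose.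
by rewrite composeA//; move: tz; rewrite dom_compose.
Qed.

Lemma ideal_sub_ideal (x y : C) : ideal x y -> ideal y `<=` ideal x.
Proof. by move=> [z /= tz <-]; exact: ideal_compose. Qed.

Lemma ideal_composeI (c a b : C) : dom c = tgt a -> dom c = tgt b ->
  ideal a `&` ideal b = set0 ->
  ideal (compose c a) `&` ideal (compose c b) = set0.
Proof.
move=> ca cb ab0; apply/seteqP; split=> // z [[x /= tx <-] [y /= ty]].
rewrite dom_compose// in tx; rewrite dom_compose// in ty.
rewrite -!composeA// => /lcsP E.
have : (ideal a `&` ideal b) (compose a x).
  split; first by exists x.
  by exists y => //; apply: E; rewrite !tgt_compose.
by rewrite ab0.
Qed.

(** Left multiplication by c, as an element of the inverse hull. *)
Definition translation (c : C) : Il C :=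
  exist (fun r => r \in Il C) _ (mem_set (Il_lmul c)).

(** The set of arrows that c can be composed with, that is d(c)C; for an object
    v it is the right ideal vC. *)
Definition Jcone (c : C) : J C := Jdom (translation c).

Lemma val_Jcone c : val (Jcone c) = [set x | tgt x = dom c].
Proof.
apply/seteqP; split=> x; first by move=> [y [z /= tz [<- _]]].
by move=> /= tx; exists (compose c x), x.
Qed.

Lemma Jcone_dom c : Jcone c = Jcone (dom c).
Proof. by apply: val_inj; rewrite !val_Jcone dom_dom. Qed.

Lemma val_Jcone_obj v : objects C v -> val (Jcone v) = ideal v.
Proof.
move=> ov; rewrite val_Jcone; apply/seteqP; split=> x /= tx.
  by exists x => //; have := compose_tgt x; rewrite tx ov.
by case: tx => y /= ty <-; rewrite tgt_compose// -[in LHS]ov tgt_dom.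
Qed.

Lemma val_Jran c : val (Jdom (Jinv (translation c))) = ideal c.
Proof.
apply/seteqP; split=> x; first by move=> [y [z /= tz [_ <-]]]; exists z.
by move=> [y /= ty <-]; exists y, y.
Qed.

Lemma Il_tgt (s : set (C * C)) : Il C s ->
  exists v w, forall x y, s (x, y) -> tgt x = dom v /\ tgt y = dom w.
Proof.
elim=> [c|{}s t _ [v [w sP]] _ [v' [w' tP]]|{}s _ [v [w sP]]].
- by exists c, (tgt c) => x y [z /= tz [<- <-]]; rewrite tgt_compose// dom_tgt.
- by exists v', w => x y [z /= /tP[-> _] /sP[_ ->]].
- by exists w, v => x y /= /sP[].
Qed.

(** Domains and ranges of elements of the inverse hull lie in a single vC,
    because this holds for left multiplications. *)
Lemma J_sub_Jcone e : exists2 v, objects C v & val e `<=` val (Jcone v).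
Proof.
case: e => /= e /set_mem[s /Il_tgt[v [w vP]] <-].
exists (dom v); first by rewrite /objects/= dom_dom.
by rewrite [pdom (lmul _)]val_Jcone => x [y /vP[]] /=; rewrite dom_dom.
Qed.

(** * Characters, maximal characters and the boundary *)

Lemma ev_le chi e f : val e `<=` val f -> ev chi e -> ev chi f.
Proof.
move=> ef; have <- : Jmeet e f = e by apply: val_inj => /=; exact/setIidPl.
by rewrite evI => /andP[].
Qed.

Lemma ev_nonempty chi e : ev chi e -> val e !=set0.
Proof.
have [_ _ chi0] := set_mem (valP chi) => chie; apply/set0P/eqP => /chi0.
by rewrite -/(ev chi e) chie.
Qed.

Lemma ev_meet chi e f : ev chi e -> ev chi f -> val e `&` val f !=set0.
Proof.
by move=> ce cf; apply: (@ev_nonempty chi (Jmeet e f)); rewrite evI ce cf.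
Qed.

Lemma ev_some chi : exists e, ev chi e.
Proof. by have [] := set_mem (valP chi). Qed.

Lemma ev_Jcone chi : exists2 v, objects C v & ev chi (Jcone v).
Proof.
have [e ce] := ev_some chi; have [v ov ve] := J_sub_Jcone e.
by exists v => //; exact: ev_le ce.
Qed.

Lemma Jcone_disjoint (v w : C) : objects C v -> objects C w ->
  val (Jcone v) `&` val (Jcone w) !=set0 -> v = w.
Proof. by move=> ov ow [x []]; rewrite !val_Jcone /= => ->; rewrite ov ow. Qed.

Lemma principal_subproof (x : C) : (fun e : J C => `[< val e x >]) \in Jhat C.
Proof.
apply/mem_set; split.
- exists (Jcone (tgt x)); apply/asboolP.
  by rewrite val_Jcone /= dom_tgt.
- by move=> e f; rewrite /= -asbool_and.
- by move=> e e0; apply/asboolP; rewrite e0.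
Qed.

(** The character that takes the value 1 exactly at the members of J containing
    x. *)
Definition principal (x : C) : Jhat C :=
  exist (fun phi => phi \in Jhat C) _ (principal_subproof x).

Lemma principalP x e : ev (principal x) e <-> val e x.
Proof. by split => /asboolP. Qed.

Lemma principal_Omega x : Omega C (principal x).
Proof.
move=> e n f ef /principalP; rewrite ef => -[i _ fx].
by exists i; apply/principalP.
Qed.

(** Zorn's lemma, applied to the filters in J that contain e. *)
Lemma maximal_exists e : val e !=set0 ->
  exists2 psi, maximal_character C psi & ev psi e.
Proof.
move=> e0.
(* The empty set satisfies P too, so that the empty chain has an upper bound. *)
pose P (S : set (J C)) := [/\ forall f g, S f -> S g -> S (Jmeet f g),
  forall f g, S f -> val f `&` val e `<=` val g -> S g &
  forall f, S f -> val f `&` val e !=set0].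
have [|A [[AI Ale A0] Amax]] := @Zorn_bigcup (J C) P.
  move=> F FP Ft; split.
  - move=> f g [S FS Sf] [T FT Tg].
    have [ST|TS] := Ft _ _ FS FT.
      by exists T => //; have [+ _ _] := FP _ FT; apply => //; exact: ST.
    by exists S => //; have [+ _ _] := FP _ FS; apply => //; exact: TS.
  - move=> f g [S FS Sf] fg; exists S => //.
    by have [_ + _] := FP _ FS; apply; eassumption.
  - by move=> f [S FS Sf]; have [_ _] := FP _ FS; apply.
have Ae : A e.
  have [//|nAe] := pselect (A e).
  suff : P [set f | val e `<=` val f].
    move/(Amax _); case; split.
      by move=> f Af; case: nAe; apply: Ale Af _; exact: subIsetr.
    by move=> /(_ e) eA; apply: nAe; apply: eA; exact: subset_refl.
  split=> /=.
  - by move=> f g ef eg x ex; split; [exact: ef|exact: eg].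
  - by move=> f g ef fg x ex; apply: fg; split => //; exact: ef.
  - by move=> f ef; have [x ex] := e0; exists x; split => //; exact: ef.
have chiP : (fun f : J C => `[< A f >]) \in Jhat C.
  apply/mem_set; split; first by exists e; apply/asboolP.
    move=> f g /=; rewrite -asbool_and; apply: asbool_equiv_eq.
    split; last by case; exact: AI.
    by move=> Afg; split; apply: Ale Afg _ => x [[]].
  by move=> f f0; apply/asboolP => /A0; rewrite f0 set0I => -[].
exists (exist (fun phi => phi \in Jhat C) _ chiP); last exact/asboolP.
move=> psi lepsi; apply/seteqP; split=> // f psif; apply/asboolP.
have lepsi' g : A g -> ev psi g by move=> Ag; apply: lepsi; exact/asboolP.
have [//|nAf] := pselect (A f).
case: (Amax (support psi)).
  by split; [exact: lepsi'|move=> /(_ f psif)].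
split.
- by move=> g h pg ph; rewrite /support/= evI; apply/andP.
- move=> g h pg gh; apply: (@ev_le psi (Jmeet g e)) => //.
  by rewrite evI (lepsi' _ Ae) andbT.
- by move=> g pg; exact: ev_meet pg (lepsi' _ Ae).
Qed.

(** A maximal character vanishes at e only because its support contains an
    element disjoint from e. *)
Lemma maximal_separates psi e : maximal_character C psi -> ~~ ev psi e ->
  exists2 f, ev psi f & val f `&` val e = set0.
Proof.
move=> psimax; apply: contraNP => H.
have nonempty f : ev psi f -> val f `&` val e !=set0.
  by move=> pf; apply/set0P/eqP => fe0; apply: H; exists f.
(* Otherwise the filter generated by psi and e is a character above psi. *)
have chiP : (fun f : J C =>
    `[< exists2 g, ev psi g & val g `&` val e `<=` val f >]) \in Jhat C.
  apply/mem_set; split.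
  - by have [f pf] := ev_some psi; exists f; apply/asboolP; exists f.
  - move=> f g /=; rewrite -asbool_and; apply: asbool_equiv_eq; split.
      by move=> [h ph hfg]; split; exists h => // x /hfg[].
    move=> [[h ph hf] [k pk kg]]; exists (Jmeet h k); first by rewrite evI ph.
    by move=> x [[hx kx] ex]; split; [exact: hf|exact: kg].
  - move=> f f0; apply/asboolP => -[g /nonempty[x gex] /(_ _ gex)].
    by rewrite f0.
pose chi : Jhat C := exist (fun phi => phi \in Jhat C) _ chiP.
suff : support psi e by [].
have <- : support chi = support psi.
  by apply: psimax => f pf; apply/asboolP; exists f.
by have [f pf] := ev_some psi; apply/asboolP; exists f.
Qed.

Lemma maximal_Omega : maximal_character C `<=` Omega C.
Proof.
move=> psi psimax e n f ef pe; apply/not_existsP => nf.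
have sep i : exists g, ev psi g /\ val g `&` val (f i) = set0.
  by have [|g] := @maximal_separates psi (f i) psimax; [exact/negP|exists g].
have /choice[g gP] := sep.
have [h ph hP] : exists2 h, ev psi h & forall i, val h `&` val (f i) = set0.
  exists (\big[@Jmeet C/e]_(i < n) g i).
    elim/big_ind : _ => // [h k ph pk|i _]; first by rewrite evI ph.
    by have [] := gP i.
  move=> i; apply/seteqP; split=> // x [+ fx]; have [_ gi] := gP i.
  rewrite -gi.
  have : i \in index_enum 'I_n by rewrite mem_index_enum.
  elim: (index_enum _) => // j r IH; rewrite big_cons inE.
  by move=> /orP[/eqP <- [gx _] //|/IH {}IH [_ /IH]].
have [x [hx]] := ev_meet ph pe.
by rewrite ef => -[i _ fx]; suff : set0 x by []; rewrite -(hP i).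
Qed.

Lemma open_evN e : open [set chi : Jhat C | ~~ ev chi e].
Proof.
have /continuousP/(_ [set false] (discrete_open _)) := @ev_continuous C e.
by congr open; apply/seteqP; split=> chi /= => [->//|/negbTE].
Qed.

(** Convergence in the space of characters is pointwise; the values are
    discrete. *)
Lemma cvg_Jhat (F : set_system (Jhat C)) chi : Filter F ->
  (forall e, \forall psi \near F, ev psi e = ev chi e) -> F --> chi.
Proof.
move=> FF Fe.
have cvgt : (fun psi => val psi : {ptws J C -> bool}) @ F -->
    (val chi : {ptws J C -> bool}).
  have ? := fmap_filter (fun psi : Jhat C => val psi) FF.
  apply/cvg_sup => e A; rewrite nbhsE => -[_ [[V oV <-] /= Ve] VA].
  apply: filterS (Fe e) => psi /= psie; apply: VA => /=.
  by rewrite -[_ e]/(ev psi e) psie.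
move=> A; rewrite nbhsE => -[_ [[V oV <-] Vchi] VA].
apply: filterS VA _; have /(_ V) := cvgt; apply.
by apply: open_nbhs_nbhs.
Qed.

Lemma cvg_bOmega (F : set_system (bOmega C)) (chi : bOmega C) : Filter F ->
  (forall e, \forall psi \near F, ev (val psi) e = ev (val chi) e) -> F --> chi.
Proof.
move=> FF Fe.
have cvgt : val @ F --> val chi by apply: cvg_Jhat => e; exact: Fe.
move=> A; rewrite nbhsE => -[_ [[V oV <-] Vchi] VA].
apply: filterS VA _; have /(_ V) := cvgt; apply.
by apply: open_nbhs_nbhs.
Qed.

Lemma closed_Omega : closed (Omega C).
Proof.
move=> chi clchi e n f ef ce; apply/not_existsP => nf.
have : nbhs chi ([set psi | ev psi e] `&` [set psi | forall i, ~~ ev psi (f i)]).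
  apply: filterI; first by apply: open_nbhs_nbhs; split => //; exact: open_ev.
  apply: (@filter_forall _ _ (fun i (psi : Jhat C) => ~~ ev psi (f i)) _
    (nbhs_filter chi)) => i.
  apply: open_nbhs_nbhs; split; first exact: open_evN.
  exact/negP.
move=> /clchi[psi [Opsi [/= pe npf]]].
by have [i pf] := Opsi e n f ef pe; have := npf i; rewrite pf.
Qed.

Lemma bOmega_Omega : bOmega C `<=` Omega C.
Proof.
move=> chi /(closure_subset maximal_Omega); exact: closed_Omega.
Qed.

Lemma invariant_Omega : invariant (Omega C).
Proof.
move=> s chi h Ochi e n f ef; rewrite ev_act => ce.
have [|i cf] := Ochi (Jconj s e) n (fun i => Jconj s (f i)) _ ce.
  apply/seteqP; split=> x; rewrite !val_Jconj.
    move=> [y [sy]]; rewrite ef => -[i _ fy]; exists i => //.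
    by rewrite val_Jconj; exists y.
  move=> [i _]; rewrite val_Jconj => -[y [sy fy]]; exists y; split => //.
  by rewrite ef; exists i.
by exists i; rewrite ev_act.
Qed.

(** At a maximal character the conditions psi(f) = 0 are redundant: the sets
    of characters with value 1 at e already form a neighbourhood basis. *)
Lemma nbhs_maximal psi (A : set (Jhat C)) : maximal_character C psi ->
  nbhs psi A -> exists2 e, ev psi e & [set chi | ev chi e] `<=` A.
Proof.
move=> psimax nA.
pose F : set_system (Jhat C) :=
  [set A | exists2 e, ev psi e & [set chi | ev chi e] `<=` A].
have FF : Filter F.
  split.
  - by have [e pe] := ev_some psi; exists e.
  - move=> S T [e pe eS] [f pf fT]; exists (Jmeet e f); first by rewrite evI pe.
    by move=> chi /=; rewrite evI => /andP[ce cf]; split; [exact: eS|exact: fT].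
  - by move=> S T ST [e pe eS]; exists e => // chi /eS /ST.
suff /(_ _ nA) : F --> psi by [].
apply: cvg_Jhat => e; case: (boolP (ev psi e)) => pe.
  by exists e => // chi /= ->.
have [f pf fe] := maximal_separates psimax pe.
exists f => // chi /= cf; apply/negP => ce.
by have [x] := ev_meet cf ce; rewrite fe.
Qed.

Lemma bOmega_maximal psi : maximal_character C psi -> bOmega C psi.
Proof. exact: subset_closure. Qed.

Lemma bOmega_ev e : val e !=set0 -> exists psi : bOmega C, ev (val psi) e.
Proof.
move=> /maximal_exists[psi /bOmega_maximal/mem_set pm pe].
by exists (exist (fun phi => phi \in bOmega C) _ pm).
Qed.

(** Every nonempty open subset of the boundary contains all the boundary
    characters with value 1 at e, for some nonempty e in J. *)
Lemma open_bOmega_basis (O : set (bOmega C)) : open O -> O !=set0 ->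
  exists psi : bOmega C, O psi /\
    exists2 e, ev (val psi) e & [set chi : bOmega C | ev (val chi) e] `<=` O.
Proof.
move=> [V oV <-] [chi Vchi].
have clchi : bOmega C (val chi) := set_mem (valP chi).
have [psi [psimax Vpsi]] := clchi V (open_nbhs_nbhs (conj oV Vchi)).
exists (exist (fun phi => phi \in bOmega C) _ (mem_set (bOmega_maximal psimax))).
split=> //; have [e pe eV] := nbhs_maximal psimax (open_nbhs_nbhs (conj oV Vpsi)).
by exists e => // phi /eV.
Qed.

(** An ultrafilter on these characters has a pointwise limit, which is again a
    character. *)
Lemma compact_bev e : compact [set chi : bOmega C | ev (val chi) e].
Proof.
rewrite compact_ultra => F UF Fe.
have FF : ProperFilter F by exact: ultra_proper.
pose D f := [set chi : bOmega C | ev (val chi) f].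
have chiP : (fun f : J C => `[< F (D f) >]) \in Jhat C.
  apply/mem_set; split.
  - by exists e; apply/asboolP.
  - move=> f g; rewrite -asbool_and; apply: asbool_equiv_eq.
    have -> : D (Jmeet f g) = D f `&` D g.
      by apply/seteqP; split=> chi; rewrite /D/= evI => /andP.
    split; last by case; exact: filterI.
    by move=> Ffg; split; apply: filterS Ffg => chi [].
  - move=> f f0; apply/asboolP => Ff; have [chi cf] := filter_ex Ff.
    by have := ev_nonempty cf; rewrite f0 => -[].
(* The pointwise limit of F. *)
pose chi : Jhat C := exist (fun phi => phi \in Jhat C) _ chiP.
have Fval : val @ F --> chi.
  apply: cvg_Jhat => f; suff : F [set psi | ev (val psi) f = ev chi f] by [].
  have [Ff|Ff] := in_ultra_setVsetC (D f) UF.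
    by apply: filterS (Ff) => psi pf /=; rewrite -[RHS]/`[< F (D f) >] asboolT.
  apply: filterS (Ff) => psi /negP/negbTE pf /=.
  rewrite pf; apply/esym/asboolP => Ff'.
  by have [? []] := filter_ex (filterI Ff Ff').
have Bchi : bOmega C chi.
  apply: closed_closure => A /Fval FA.
  have [psi Apsi] := @filter_ex _ F _ _ FA.
  by exists (val psi); split => //; exact: (set_mem (valP psi)).
exists (exist (fun phi => phi \in bOmega C) _ (mem_set Bchi)); split.
  exact/asboolP.
apply: cvg_bOmega => f; apply: (Fval [set psi | ev psi f = ev chi f]).
case: (boolP (ev chi f)) => cf.
  have := open_nbhs_nbhs (conj (open_ev f) cf).
  by apply: filterS => psi /= ->.
have := open_nbhs_nbhs (conj (open_evN f) cf).
by apply: filterS => psi /= /negbTE.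
Qed.

(** When c lies in e, left multiplication by c moves every character at which
    it is defined to one with value 1 at e. *)
Lemma translate_into (c : C) chi e (h : ev chi (Jdom (translation c))) :
  val e c -> ev (act h) e.
Proof.
move=> ec; apply: (ev_le _ (act_ran h)); rewrite val_Jran; exact: ideal_sub.
Qed.

(** * Minimality of the boundary *)

(** Any two objects are joined by an arrow, in both directions. *)
Definition connected_objects :=
  forall v w : C, objects C v -> objects C w -> homset w v !=set0.

Lemma connected_arrow (x v : C) : connected_objects -> objects C v ->
  exists2 c, ideal x c & dom c = v.
Proof.
move=> conn ov.
have [|y [ty dy]] := conn v (dom x) ov; first by rewrite /objects/= dom_dom.
exists (compose x y); last by rewrite dom_compose.
by exists y.
Qed.

Lemma nonempty_bOmega : objects C !=set0 -> bOmega C !=set0.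
Proof.
move=> [v ov]; have [|psi _] := @bOmega_ev (Jcone v).
  by rewrite val_Jcone_obj//; exists v; exact: ideal_self.
by exists (val psi); exact: (set_mem (valP psi)).
Qed.

Lemma connected_smallest : objects C !=set0 -> connected_objects ->
  smallest_closed_invariant [set: Jhat C] (bOmega C).
Proof.
move=> C0 conn; split.
  split=> //; first exact: nonempty_bOmega; last exact: invariant_bOmega.
  by apply/closed_subspaceP; exists (bOmega C) => //; exact: closed_closure.
move=> Z [_ [chi Zchi] /closed_subspaceP[V cV VZ] Zinv].
have {}VZ : V = Z by move: VZ; rewrite !setIT.
(* Near psi there is a set of characters with chi(e) = 1, for a nonempty e in
   J; a translation moves the given point of Z into it. *)
move=> psi psicl; rewrite -VZ; apply: cV => A nA.
move: nA; rewrite nbhsE => -[W [oW Wpsi] WA].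
have [phi [phimax Wphi]] := psicl _ (open_nbhs_nbhs (conj oW Wpsi)).
have [e pe eW] := nbhs_maximal phimax (open_nbhs_nbhs (conj oW Wphi)).
have [x ex] := ev_nonempty pe.
have [v ov cv] := ev_Jcone chi.
have [c xc dc] := connected_arrow x conn ov.
have h : ev chi (Jdom (translation c)) by rewrite -/(Jcone c) Jcone_dom dc.
exists (act h); split; first by rewrite VZ; exact: Zinv.
by apply/WA/eW/translate_into; exact: (ideal_sub ex).
Qed.

Lemma smallest_Omega :
  smallest_closed_invariant [set: Jhat C] (bOmega C) ->
  smallest_closed_invariant (Omega C) (bOmega C).
Proof.
move=> [[_ B0 _ Binv] Bmin]; split.
  split=> //; first exact: bOmega_Omega.
  by apply/closed_subspaceP; exists (bOmega C) => //; exact: closed_closure.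
move=> Z [ZO Z0 /closed_subspaceP[V cV VZ] Zinv]; apply: Bmin; split=> //.
apply/closed_subspaceP; exists (V `&` Omega C).
  by apply: closedI => //; exact: closed_Omega.
by rewrite !setIT VZ; exact/setIidPl.
Qed.

(** If no arrow goes from v to w, the closure of the orbit of the principal
    character at v misses the boundary characters with value 1 at wC. *)
Lemma smallest_connected :
  smallest_closed_invariant (Omega C) (bOmega C) -> connected_objects.
Proof.
move=> [_ Bmin] v w ov ow; apply/set0P/eqP => hom0.
(* Z consists of the characters of Omega whose orbit avoids the open set of
   the psi with psi(wC) = 1. *)
pose Z := [set chi | Omega C chi /\ forall s, ~~ ev chi (Jconj s (Jcone w))].
have [|psi psimax pw] := @maximal_exists (Jcone w).
  by rewrite val_Jcone_obj//; exists w; exact: ideal_self.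
have [||_ /(_ (translation w))] := Bmin Z _ psi; last 1 first.
- rewrite (_ : Jconj _ _ = Jcone w) ?pw//; apply: val_inj.
  rewrite val_Jconj val_Jcone; apply/seteqP; split=> x.
    by move=> [y [[z /= tz [<- _]]]].
  move=> /= tx; exists (compose w x); split; first by exists x.
  by rewrite /= tgt_compose -?tx// tx -[in LHS]ow tgt_dom ow.
- split.
  + by move=> chi [].
  + exists (principal v); split; first exact: principal_Omega.
    move=> s; apply/negP => /principalP; rewrite val_Jconj => -[y [svy]].
    rewrite val_Jcone /= ow => ty.
    have [dvy _] := Il_equivariant (set_mem (valP s)) svy; rewrite ov in dvy.
    by have : homset w v y by []; rewrite hom0.
  + apply/closed_subspaceP.
    exists (\bigcap_(s : Il C) [set chi | ~~ ev chi (Jconj s (Jcone w))]).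
      apply: closed_bigI => s _; rewrite -openC.
      have := open_ev (Jconj s (Jcone w)); congr open.
      by apply/seteqP; split => chi /= ; [move=> ->|move=> /negP; rewrite negbK].
    apply/seteqP; split=> chi /= [H O]; split=> //.
      by split=> // s; exact: H.
    by move=> s _; exact: H.2.
  + move=> t chi h [Ochi chiw]; split; first exact: invariant_Omega.
    move=> s; rewrite ev_act.
    pose r : Il C := exist (fun r => r \in Il C) _
      (mem_set (Il_comp (set_mem (valP s)) (set_mem (valP t)))).
    suff -> : Jconj t (Jconj s (Jcone w)) = Jconj r (Jcone w) by [].
    apply: val_inj; rewrite !val_Jconj; apply/seteqP; split=> x.
      by move=> [y [ty [z [sz wz]]]]; exists z; split=> //; exists y.
    by move=> [z [[y /= ty sz] wz]]; exists y; split=> //; exists z.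
- exact: bOmega_maximal.
Qed.

(** * Pure infiniteness *)

Lemma ev_Jconj_act s chi (h : ev chi (Jdom s)) e :
  ev chi e -> ev (act h) (Jconj (Jinv s) e).
Proof. by move=> ce; rewrite ev_act Jconj_Jinv evI ce h. Qed.

Lemma act_inj s chi psi (h : ev chi (Jdom s)) (k : ev psi (Jdom s)) :
  act h = act k -> chi = psi.
Proof.
move=> hk; apply: Jhat_ext => e.
have := congr1 (fun phi => ev phi (Jconj (Jinv s) e)) hk.
by rewrite !ev_act !Jconj_Jinv !evI h k !andbT.
Qed.

Lemma actVK s chi (h : ev chi (Jdom (Jinv s))) (k : ev (act h) (Jdom s)) :
  act k = chi.
Proof.
apply: Jhat_ext => e; rewrite !ev_act -{2}(JinvK s) Jconj_Jinv evI.
by rewrite h andbT.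
Qed.

(** The source map is a homeomorphism on an open set where it is injective. *)
Lemma compact_germ_section (U : set (germ C)) : open U ->
  {in U &, injective (@germ_src C)} -> compact (@germ_src C @` U) -> compact U.
Proof.
move=> oU Uinj cU F FF FU.
have sF : ProperFilter (@germ_src C @ F) by exact: fmap_proper_filter.
have srcF A : F A -> (@germ_src C @ F) (@germ_src C @` A).
  by move=> FA; apply: (@filterS _ F _ A) => // g Ag; exists g.
have [_ [[g Ug <-] clg]] := cU (@germ_src C @ F) sF (srcF _ FU).
exists g; split=> // A V FA; rewrite nbhsE => -[W [oW Wg] WV].
have [||_ [[a [Aa Ua] <-] [w [Ww Uw] wa]]] :=
    clg (@germ_src C @` (A `&` U)) (@germ_src C @` (W `&` U)).
- by apply: srcF; exact: filterI.
- apply: open_nbhs_nbhs; split; last by exists g.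
  by apply: germ_src_open; exact: openI.
exists a; split=> //; apply: WV.
by rewrite (Uinj a w) ?inE.
Qed.

(** The objects v such that B contains a character with value 1 at vC. The
    sets of characters with value 1 at vC, for v an object, partition the
    character space. *)
Definition met_objects (B : set (bOmega C)) : set C :=
  [set v | objects C v /\ exists2 chi, B chi & ev (val chi) (Jcone v)].

Lemma finite_met_objects B : compact B -> finite_set (met_objects B).
Proof.
move=> /compact_near_coveringP cB.
(* The filter of the statements that hold for all large finite sets. *)
pose F : set_system (set C) := [set P | exists2 D0, finite_set D0 &
  forall D, finite_set D -> D0 `<=` D -> P D].
have FF : Filter F.
  split.
  - by exists set0.
  - move=> P Q [D0 D0fin PP] [D1 D1fin QQ]; exists (D0 `|` D1).
      by rewrite finite_setU.
    by move=> D Dfin D01; split; [apply: PP|apply: QQ] => // x Dx; apply: D01;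
      [left|right].
  - by move=> P Q PQ [D0 D0fin PP]; exists D0 => // D Dfin /PP -/(_ Dfin)/PQ.
have [|D Dfin /(_ D Dfin) BD] := cB _ F
    (fun D (chi : bOmega C) =>
      exists2 v, objects C v /\ D v & ev (val chi) (Jcone v)) FF.
  move=> chi _; have [v ov cv] := ev_Jcone (val chi).
  exists ([set psi : bOmega C | ev (val psi) (Jcone v)], [set D | D v]).
    split; first by apply: open_nbhs_nbhs; split => //; exact: open_bev.
    by exists [set v] => [|D _ /(_ v)]; [exact: finite_set1|exact].
  by move=> [psi D] /= [pv Dv]; exists v.
apply: sub_finite_set Dfin => v [ov [chi Bchi cv]].
have [w [ow Dw] cw] := BD (@subset_refl _ D) chi Bchi.
by rewrite (Jcone_disjoint ov ow (ev_meet cv cw)).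
Qed.

(** The germs, at the characters of B with value 1 at vC, of the left
    multiplication by c v, where v runs over the objects; it is a bisection with
    source B when c v starts at v and the ideals of the c v are disjoint. *)
Definition translation_bisection (c : C -> C) (B : set (bOmega C)) :
    set (germ C) :=
  \bigcup_(v in met_objects B)
    (germ_bisection (translation (c v)) `&` @germ_src C @^-1` B).

Lemma translation_bisectionP (c : C -> C) (B : set (bOmega C)) :
  (forall v, met_objects B v -> dom (c v) = v) -> compact B -> open B ->
  (forall v w, met_objects B v -> met_objects B w -> v <> w ->
    ideal (c v) `&` ideal (c w) = set0) ->
  let U := translation_bisection c B in
  [/\ compact_open_bisection (@germ_src C) (@germ_rng C) U,
    @germ_src C @` U = B &
    forall chi : bOmega C, (@germ_rng C @` U) chi -> exists2 v, met_objects B v &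
      exists2 e, val e = ideal (c v) & ev (val chi) e].
Proof.
move=> cdom cB oB cdisj U.
have srcE : @germ_src C @` U = B.
  apply/seteqP; split=> chi; first by move=> [g [v _ [_ Bg]] <-].
  move=> Bchi; have [v ov cv] := ev_Jcone (val chi).
  have Bv : met_objects B v by split=> //; exists chi.
  have h : ev (val chi) (Jdom (translation (c v))).
    by rewrite -/(Jcone (c v)) Jcone_dom cdom.
  exists (mk_germ h); last exact: germ_src_mk.
  by exists v => //; split; [exists chi, h|rewrite /= germ_src_mk].
have rngP (chi : bOmega C) : (@germ_rng C @` U) chi -> exists2 v, met_objects B v &
      exists2 e, val e = ideal (c v) & ev (val chi) e.
  move=> [g [v Bv [[psi [h ->]] _]] <-]; exists v => //.
  exists (Jdom (Jinv (translation (c v)))); first exact: val_Jran.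
  by rewrite germ_rng_mk; exact: act_ran.
have oU : open U.
  apply: bigcup_open => v _; apply: openI; first exact: germ_bisection_open.
  by have /continuousP := @germ_src_continuous C; exact.
have gJcone v g : met_objects B v -> germ_bisection (translation (c v)) g ->
    ev (val (germ_src g)) (Jcone v).
  move=> Bv [chi [h ->]]; rewrite germ_src_mk.
  by rewrite -[in Jcone v](cdom v)// -Jcone_dom.
have Usrc : {in U &, injective (@germ_src C)}.
  move=> g g' /set_mem[v Bv [gv _]] /set_mem[w Bw [gw _]] gg'.
  suff vw : v = w by apply: (germ_src_inj gv) => //; rewrite vw.
  apply: (Jcone_disjoint Bv.1 Bw.1).
  by apply: ev_meet (gJcone _ _ Bv gv) _; rewrite gg'; exact: gJcone.
have Urng : {in U &, injective (@germ_rng C)}.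
  move=> g g' /set_mem[v Bv [[chi [h ->]] _]] /set_mem[w Bw [[psi [k ->]] _]].
  rewrite !germ_rng_mk => hk.
  have vw : v = w.
    have [//|vw] := pselect (v = w).
    have cv := act_ran h; have cw := act_ran k.
    have ac : act h = act k := congr1 val hk.
    rewrite -ac in cw; have [x] := ev_meet cv cw.
    by rewrite !val_Jran cdisj.
  rewrite {}vw in h hk *.
  have cp : chi = psi.
    by apply: val_inj; exact: (@act_inj _ _ _ h k (congr1 val hk)).
  by rewrite {}cp in h hk *; rewrite (bool_irrelevance h k).
split=> //; split=> //.
by apply: compact_germ_section; rewrite ?srcE.
Qed.

(** A nonempty open set of germs contains the germs of one s at an open set of
    characters, which s maps onto an open set. *)
Lemma bisection_range (U : set (germ C)) : open U -> U !=set0 ->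
  exists2 e, val e !=set0 &
    [set chi : bOmega C | ev (val chi) e] `<=` @germ_rng C @` U.
Proof.
move=> oU [g Ug]; have [s [chi [h gE]]] := mk_germ_ex g.
have [|psi [[k Upsi] [e pe eU]]] := open_bOmega_basis (oU s).
  by exists chi, h; rewrite -gE.
(* The characters that s^-1 maps into those with value 1 at e. *)
exists (Jconj (Jinv s) e).
  apply: (@ev_nonempty (act k)); exact: ev_Jconj_act.
move=> phi /= phie.
have phis : ev (val phi) (Jdom (Jinv s)).
  by apply: ev_le phie => x; rewrite val_Jconj => -[y [sy _]]; exists y.
have /eU[m Um] : ev (val (bact phis)) e by rewrite ev_act.
exists (mk_germ m) => //; rewrite germ_rng_mk; apply: val_inj.
exact: actVK.
Qed.

(** Every object v has two arrows with target v and disjoint right ideals. *)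
Definition has_disjoint_ideals := forall v : C, objects C v ->
  exists a b : C, [/\ ideal v a, ideal v b & ideal a `&` ideal b = set0].

Lemma purely_infinite_disjoint_ideals :
  purely_infinite (@germ_src C) (@germ_rng C) -> has_disjoint_ideals.
Proof.
move=> pinf v ov; pose B := [set chi : bOmega C | ev (val chi) (Jcone v)].
have [U [V [[_ oU _] [_ oV _] [sU sV] UVB UV0]]] :=
  pinf B (@compact_bev (Jcone v)) (open_bev (Jcone v)).
have [chi Bchi] : B !=set0.
  by apply: bOmega_ev; rewrite val_Jcone_obj//; exists v; exact: ideal_self.
have [e [x ex] eU] : exists2 e, val e !=set0 &
    [set chi : bOmega C | ev (val chi) e] `<=` @germ_rng C @` U.
  by apply: bisection_range => //; move: Bchi; rewrite -sU => -[g]; exists g.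
have [f [y fy] fV] : exists2 e, val e !=set0 &
    [set chi : bOmega C | ev (val chi) e] `<=` @germ_rng C @` V.
  by apply: bisection_range => //; move: Bchi; rewrite -sV => -[g]; exists g.
have meets e' (W : set (germ C)) : @germ_rng C @` W `<=` B -> val e' !=set0 ->
    [set chi : bOmega C | ev (val chi) e'] `<=` @germ_rng C @` W ->
    exists2 a, ideal v a & val e' a.
  move=> WB /bOmega_ev[psi pe] /(_ _ pe) /WB pv.
  by have [a [ea]] := ev_meet pe pv; rewrite val_Jcone_obj// => va; exists a.
have [|a va ea] := meets e U _ (ex_intro _ x ex) eU.
  by move=> psi Upsi; apply: UVB; left.
have [|b vb fb] := meets f V _ (ex_intro _ y fy) fV.
  by move=> psi Vpsi; apply: UVB; right.
exists a, b; split=> //; apply/seteqP; split=> // z [az bz].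
have [|psi] := @bOmega_ev (Jmeet e f).
  by exists z; split; [exact: ideal_sub az|exact: ideal_sub bz].
by rewrite evI => /andP[/eU pU /fV pV]; suff : set0 psi by []; rewrite -UV0.
Qed.

(** Two disjoint ideals below every object give infinitely many below any
    arrow. *)
Lemma disjoint_ideals_seq (x : C) : has_disjoint_ideals ->
  exists z : nat -> C, (forall n, ideal x (z n)) /\
    forall n m, n <> m -> ideal (z n) `&` ideal (z m) = set0.
Proof.
move=> H.
have step (c : C) : exists ab : C * C, [/\ ideal c ab.1, ideal c ab.2 &
    ideal ab.1 `&` ideal ab.2 = set0].
  have [|a [b [[a' /= ta aE] [b' /= tb bE] ab]]] := H (dom c).
    by rewrite /objects/= dom_dom.
  rewrite dom_dom in ta tb.
  have da : a = a' by rewrite -aE -ta compose_tgt.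
  have db : b = b' by rewrite -bE -tb compose_tgt.
  exists (compose c a', compose c b'); split; [by exists a'|by exists b'|].
  by apply: ideal_composeI; rewrite // -da -db.
have /choice[ab abP] := step.
(* Keep splitting the second of the two disjoint ideals. *)
pose p := fix p n := if n is m.+1 then (ab (p m)).2 else x.
have pS n m : (n <= m)%N -> ideal (p m) `<=` ideal (p n).
  move=> /subnK <-; elim: (m - n)%N => [//|k IH].
  rewrite addSn /=; apply: subset_trans IH.
  by have [_ + _] := abP (p (k + n)%N); exact: ideal_sub_ideal.
exists (fun n => (ab (p n)).1); split=> [n|].
  by have [+ _ _] := abP (p n); exact: (pS 0%N).
have lt n m : (n < m)%N -> ideal (ab (p n)).1 `&` ideal (ab (p m)).1 = set0.
  move=> nm; apply/seteqP; split=> // y [yn ym].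
  have [_ _ <-] := abP (p n); split => //.
  by apply: (pS _ _ nm); have [/ideal_sub_ideal + _ _] := abP (p m); apply.
by move=> n m /eqP; rewrite neq_ltn => /orP[/lt//|/lt]; rewrite setIC.
Qed.

(** Each of the finitely many pieces of B is translated into an ideal of its
    own, twice, inside one basic open subset of B. *)
Lemma disjoint_ideals_purely_infinite : connected_objects ->
  has_disjoint_ideals -> purely_infinite (@germ_src C) (@germ_rng C).
Proof.
move=> conn H B cB oB.
have [->|/set0P B0] := eqVneq B set0.
  exists set0, set0; rewrite !image_set0 setU0 setI0; split => //.
  1,2: split; [exact: compact0|exact: open0|].
  1,2: by split=> g g' /set_mem.
have [_ [_ [e /ev_nonempty[x ex] eB]]] := open_bOmega_basis oB B0.
have [z [zx zdisj]] := disjoint_ideals_seq x H.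
have /choice[c cP] : forall nv : nat * C, exists c : C,
    objects C nv.2 -> ideal (z nv.1) c /\ dom c = nv.2.
  move=> [n v]; have [ov|] := pselect (objects C v); last by exists v.
  by have [c zc dc] := connected_arrow (z n) conn ov; exists c.
have [idx idx_inj] : exists idx : C -> nat, {in met_objects B &, injective idx}.
  by apply/pcard_injP/finite_set_countable/finite_met_objects.
(* Odd indices (b = true) serve the first bisection, even ones the second. *)
pose tr (b : bool) v := c (b + (idx v).*2, v)%N.
have trP (b : bool) v : met_objects B v ->
    ideal (z (b + (idx v).*2)%N) (tr b v) /\ dom (tr b v) = v.
  by case=> ov _; exact: (cP (_, v)).
have trdisj (b b' : bool) v w : met_objects B v -> met_objects B w ->
    b <> b' \/ v <> w -> ideal (tr b v) `&` ideal (tr b' w) = set0.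
  move=> Bv Bw bv; apply/seteqP; split=> // y [yv yw].
  have nm : (b + (idx v).*2 <> b' + (idx w).*2)%N.
    move=> E; have bb' : b = b'.
      by have := congr1 odd E; rewrite !oddD !odd_double !oddb !addbF.
    case: bv => // vw; apply: vw; apply: idx_inj; rewrite ?inE//.
    by have := congr1 half E; rewrite !half_bit_double.
  rewrite -(zdisj _ _ nm); split.
    exact: ideal_sub_ideal (trP b v Bv).1 _ yv.
  exact: ideal_sub_ideal (trP b' w Bw).1 _ yw.
have bis b := @translation_bisectionP (tr b) B (fun v Bv => (trP b v Bv).2) cB oB
  (fun v w Bv Bw vw => trdisj b b v w Bv Bw (or_intror vw)).
have [bU sU rU] := bis true; have [bV sV rV] := bis false.
have rB b : @germ_rng C @` translation_bisection (tr b) B `<=` B.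
  have [_ _ r] := bis b => chi /r[v Bv [f fE cf]]; apply: eB => /=.
  apply: ev_le cf; rewrite fE.
  apply: subset_trans (ideal_sub ex); apply: subset_trans (ideal_sub_ideal (zx _)).
  exact: ideal_sub_ideal (trP b v Bv).1.
exists (translation_bisection (tr true) B), (translation_bisection (tr false) B).
split=> //; first by move=> chi [/rB|/rB].
apply/seteqP; split=> // chi [/rU[v Bv [f fE cf]] /rV[w Bw [g gE cg]]].
have [y] := ev_meet cf cg.
by rewrite fE gE trdisj//; left.
Qed.

End InverseHullTheory.

Theorem proposition5p21 (C : lcsCat) (C_nonempty : objects C !=set0) :
  [/\ smallest_closed_invariant [set: Jhat C] (bOmega C) <->
      smallest_closed_invariant (Omega C) (bOmega C),
      smallest_closed_invariant (Omega C) (bOmega C) <->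
      (forall v w : C, objects C v -> objects C w -> homset w v !=set0) &
      (forall v w : C, objects C v -> objects C w -> homset w v !=set0) ->
      (purely_infinite (@germ_src C) (@germ_rng C) <->
       forall v : C, objects C v ->
         exists a b : C, [/\ ideal v a, ideal v b & ideal a `&` ideal b = set0])].
Proof.
have ba : smallest_closed_invariant (Omega C) (bOmega C) ->
    smallest_closed_invariant [set: Jhat C] (bOmega C).
  by move=> /smallest_connected; exact: connected_smallest.
split; first by split; [exact: smallest_Omega|exact: ba].
  split; first exact: smallest_connected.
  by move=> /(connected_smallest C_nonempty); exact: smallest_Omega.
move=> conn; split; first exact: purely_infinite_disjoint_ideals.
exact: disjoint_ideals_purely_infinite.
Qed.
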